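(* Let $q,r$ be real piecewise continuous functions on $[a,b]$ such that the Dirichlet problem $-y''+q(x)y=\lambda r(x)y$, $y(a)=y(b)=0$ is non-definite, and let $y=\varphi+i\psi$ ($\varphi={\rm Re}\,y$, $\psi={\rm Im}\,y$) be a complex ghost belonging to a non-real eigenvalue $\lambda$ with ${\rm Im}\,\lambda>0$. Put $G(x)=\int_a^x r|y|^2\,dt$ and suppose $G(x)<0$ for all $x\in(a,b)$. Suppose $\psi'(a)<0$ and that $\psi$ has a zero in $(a,b)$; let $x_0\in(a,b)$ be the smallest zero of $\psi$ in $(a,b)$. (1) If $\varphi'(a)>0$, then $\varphi(x)>0$ in $(a,x_0)$. (2) If $\varphi'(a)<0$, then $\varphi$ vanishes exactly once in $(a,x_0)$. (3) If $\varphi'(a)=0$, then the conclusion of one of the first two cases must occur, i.e. either $\varphi>0$ in $(a,x_0)$ or $\varphi$ vanishes exactly once in $(a,x_0)$.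
   Context: The problem is called non-definite if each of the quadratic forms $y\mapsto\int_a^b(|y'|^2+q|y|^2)\,dx$ and $y\mapsto\int_a^b r|y|^2\,dx$ takes both positive and negative values on the domain of the Dirichlet problem. Solutions are $C^1$ functions with absolutely continuous derivative satisfying the equation almost everywhere. A complex ghost is a non-trivial eigenfunction belonging to a non-real eigenvalue. *)

(* Defs.v *)
From HB Require Import structures.
From mathcomp Require Import all_boot all_order all_algebra.
From mathcomp Require Export complex.
From mathcomp Require Import all_classical all_reals all_analysis.
Set Implicit Arguments.
Unset Strict Implicit.
Unset Printing Implicit Defensive.
Import Order.TTheory GRing.Theory Num.Theory.
Import numFieldNormedType.Exports.
Local Open Scope classical_set_scope.
Local Open Scope ring_scope.
Local Open Scope complex_scope.

Section segment.
Context {R : realType}.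
Variables a b : R.
Implicit Types (f q r : R -> R) (y : R -> R[i]) (lambda : R[i]) (x t : R).

(* At each of the partition points a = t_0 < ... < t_n = b the value of f is
   arbitrary, but the one-sided limits are required to exist and be finite. *)
Definition piecewise_continuous f :=
  exists s : seq R, itv_partition a b s /\
    forall i, (i < size s)%N ->
      let u := nth b (a :: s) i in
      let v := nth b (a :: s) i.+1 in
      [/\ forall x, u < x < v -> {for x, continuous f},
          cvg (f t @[t --> u^'+]) &
          cvg (f t @[t --> v^'-])].

(* Derivatives of functions on the segment [a, b]: difference quotients are
   taken inside [a, b], so the derivative is one-sided at a and at b and does
   not depend on the (junk) values of f outside [a, b]. *)
Definition derivable_seg f x : Prop :=
  cvg ((f t - f x) / (t - x) @[t --> within `[a, b] x^']).

Definition derive_seg f x : R :=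
  lim ((f t - f x) / (t - x) @[t --> within `[a, b] x^']).

Definition derivable_segC y x : Prop :=
  derivable_seg (fun t => complex.Re (y t)) x /\
  derivable_seg (fun t => complex.Im (y t)) x.

Definition derive_segC y x : R[i] :=
  derive_seg (fun t => complex.Re (y t)) x +i*
  derive_seg (fun t => complex.Im (y t)) x.

(* The real-valued modulus; `|z| would be an element of R[i]. *)
Definition modulus (z : R[i]) : R := ComplexField.Normc.normc z.

Definition abs_continuousC y : Prop :=
  forall e : R, 0 < e -> exists2 d : R, 0 < d &
    forall (n : nat) (u v : 'I_n -> R),
      (forall i, [/\ a <= u i, u i <= v i & v i <= b]) ->
      trivIset setT (fun i => `]u i, v i[%classic) ->
      \sum_i (v i - u i) < d ->
      \sum_i modulus (y (v i) - y (u i)) < e.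

(* Continuity of the derivative follows from its absolute continuity. *)
Definition C1_ac_derivative y : Prop :=
  (forall x, a <= x <= b -> derivable_segC y x) /\
  abs_continuousC (derive_segC y).

Definition dirichlet_domain y : Prop :=
  [/\ C1_ac_derivative y, y a = 0 & y b = 0].

Definition left_form q y : R :=
  \int[lebesgue_measure]_(x in `[a, b])
     (modulus (derive_segC y x) ^+ 2 + q x * modulus (y x) ^+ 2).

Definition right_form r y : R :=
  \int[lebesgue_measure]_(x in `[a, b]) (r x * modulus (y x) ^+ 2).

Definition indefinite_form (Q : (R -> R[i]) -> R) : Prop :=
  (exists2 y, dirichlet_domain y & 0 < Q y) /\
  (exists2 y, dirichlet_domain y & Q y < 0).

Definition non_definite q r : Prop :=
  indefinite_form (left_form q) /\ indefinite_form (right_form r).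

Definition solution q r lambda y : Prop :=
  C1_ac_derivative y /\
  {ae lebesgue_measure, forall x, a <= x <= b ->
     derivable_segC (derive_segC y) x /\
     - derive_segC (derive_segC y) x + (q x)%:C * y x =
       lambda * (r x)%:C * y x}.

(* The existence of such a y is what makes lambda an eigenvalue. *)
Definition eigenfunction q r lambda y : Prop :=
  [/\ solution q r lambda y, y a = 0, y b = 0 &
      exists2 x, a <= x <= b & y x != 0].

Definition complex_ghost q r lambda y : Prop :=
  eigenfunction q r lambda y /\ complex.Im lambda != 0.

End segment.

(* Main.v *)
(* The Wronskian-type function W = phi' psi - phi psi' vanishes at a and, by the
   differential equation, has derivative (Im lambda) r |y|^2 almost everywhere.
   It is absolutely continuous, so W = (Im lambda) G, which is negative on
   (a, b). On (a, x0), where psi < 0, the quotient phi / psi has derivative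
   W / psi^2 < 0, so it decreases strictly from its limit phi'(a) / psi'(a) at a;
   if that limit is at most 0 then phi > 0, otherwise phi has at most one zero.
   At x0 one has W = - phi psi' < 0 with psi' >= 0, so phi(x0) > 0, and a zero
   exists as soon as phi is negative near a. *)

Require Import Defs.
From HB Require Import structures.
From mathcomp Require Import all_boot all_order all_algebra.
From mathcomp Require Import complex.
From mathcomp Require Import all_classical all_reals all_analysis.
From mathcomp Require Import measurable_realfun.
From mathcomp Require Import ring lra.
Set Implicit Arguments.
Unset Strict Implicit.
Unset Printing Implicit Defensive.
Import Order.TTheory GRing.Theory Num.Theory.
Import numFieldNormedType.Exports.
Local Open Scope classical_set_scope.
Local Open Scope ring_scope.
Local Open Scope complex_scope.

(** * Absolutely continuous functions whose derivative vanishes almost everywhere *)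

(** The supremum of the points reached from [a] can be crossed by the local hypothesis at that
    supremum, so it must be [b]. This replaces the extraction of a finite tagged partition by
    compactness. *)
Lemma cousin_additive (R : realType) (a b : R) (P : R -> R -> Prop) :
  a <= b ->
  (forall x y z, a <= x -> x <= y -> y <= z -> z <= b ->
    P x y -> P y z -> P x z) ->
  (forall x, a <= x <= b -> exists2 d : R, 0 < d &
    forall u v, a <= u -> v <= b -> u <= x <= v -> x - d < u -> v < x + d ->
    P u v) ->
  P a b.
Proof.
move=> ab Padd Ploc.
pose E := [set x | a <= x <= b /\ P a x].
have Ea : E a.
  have [|d d0 Pd] := Ploc a; first by rewrite lexx ab.
  by split; [rewrite lexx ab|apply: Pd => //; rewrite ?lexx//; lra].
have Eub : ubound E b by move=> x [/andP[]].
have hsE : has_sup E by split; [exists a|exists b].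
have aS : a <= sup E by exact: (ub_le_sup (proj2 hsE) Ea).
have Sb : sup E <= b by apply: ge_sup => //; exists a.
have [|d d0 Pd] := Ploc (sup E); first by rewrite aS.
have [x [/andP[ax xb] Pax] xS] := sup_adherent d0 hsE.
have xleS : x <= sup E by apply: ub_le_sup; [exact: proj2 hsE|split; rewrite ?ax].
(* The point [m] lies beyond the supremum unless [b] comes first; since [m] is again reached from
   [a], the supremum can only be [b]. *)
pose m := Num.min b (sup E + d / 2).
have Sm : sup E <= m by rewrite le_min Sb; lra.
have mb : m <= b by rewrite ge_min lexx.
have md : m <= sup E + d / 2 by rewrite ge_min lexx orbT.
have Pam : P a m.
  apply: (Padd a x m) => //; first lra.
  by apply: Pd => //; [rewrite xleS Sm|lra].
have mS : m <= sup E.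
  by apply: ub_le_sup; [exact: proj2 hsE|split => //; rewrite mb (le_trans aS)].
suff -> : b = m by [].
move: mS; rewrite /m /Num.min; case: ifP => // _; lra.
Qed.

Definition abs_continuous (R : realType) (a b : R) (f : R -> R) :=
  forall e : R, 0 < e -> exists2 d : R, 0 < d &
    forall (n : nat) (u v : 'I_n -> R),
      (forall i, [/\ a <= u i, u i <= v i & v i <= b]) ->
      trivIset setT (fun i => `]u i, v i[%classic) ->
      \sum_i (v i - u i) < d ->
      \sum_i `|f (v i) - f (u i)| < e.

(* Cousin's argument: outside a null set N the increments of f over small
   intervals around a point are at most e times the length; the intervals
   tagged in N lie in an open set U of small measure, so that absolute
   continuity bounds the sum of the corresponding increments. *)
Lemma abs_continuous_cst_ae (R : realType) (a b : R) (f : R -> R) :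
  a <= b -> abs_continuous a b f ->
  {ae lebesgue_measure, forall x, a < x < b -> is_derive x 1 f 0} ->
  f a = f b.
Proof.
move=> ab acf /negligible_outer_measure.
set N := (X in (wlength idfun)^*%mu X = _) => N0.
suff H e : 0 < e -> `|f b - f a| <= e * (b - a) + e.
  apply/eqP; rewrite eq_sym -subr_eq0 -normr_le0 leNgt; apply/negP => fab.
  have p : 0 < b - a + 1 by lra.
  (* With this value of [e], the bound [e * (b - a) + e] is half of the increment that it should
     dominate. *)
  have fab2 : 0 < `|f b - f a| / 2 / (b - a + 1) by rewrite !divr_gt0.
  have := H _ fab2; rewrite -[X in _ <= _ + X]mulr1 -mulrDr divfK ?gt_eqF//; lra.
move=> e0; have [d d0 acd] := acf _ e0.
(* The derivative is only controlled in the open interval, so both endpoints are treated as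
   exceptional points. *)
pose N' := N `|` [set a; b].
have N'0 : ((wlength idfun)^*%mu N' = 0)%E.
  apply/negligible_outer_measure/negligibleU; first exact/negligible_outer_measure.
  exists [set a; b]; split; [exact: measurableU| |by []].
  by apply: countable_lebesgue_measure0; exact/finite_set_countable.
have d20 : 0 < d / 2 by rewrite divr_gt0.
have [U [oU NU]] := @outer_measure_open_le R N' _ d20.
rewrite N'0 add0e => muU.
have mU : measurable U by exact: open_measurable.
(* The finite disjoint family collects the intervals inside [U], whose increments cannot be bounded
   by their length. Concatenating two families makes the property additive. *)
pose P x y := exists n (u v : 'I_n -> R),
  [/\ forall i, [/\ x <= u i, u i <= v i, v i <= y & `]u i, v i[ `<=` U],
      trivIset setT (fun i => `]u i, v i[%classic) &
      `|f y - f x| <= e * (y - x) + \sum_i `|f (v i) - f (u i)|].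
have [n [u [v [uvU tuv fab]]]] : P a b.
  apply: cousin_additive => //.
  - move=> x y z ax xy yz zb [n [u [v [h1 t1 s1]]]] [m [s [t [h2 t2 s2]]]].
    pose w (p : 'I_n -> R) (q : 'I_m -> R) i :=
      match fintype.split i with inl j => p j | inr k => q k end.
    exists (n + m)%N, (w u s), (w v t); split.
    + rewrite /w => i; case: (fintype.split i) => j.
        have [? ? ? ?] := h1 j; split => //; exact: le_trans yz.
      by have [? ? ? ?] := h2 j; split => //; exact: le_trans xy _.
    + move=> i j _ _ [c []]; rewrite /w.
      case: (splitP i) => i' ei; case: (splitP j) => j' ej /=;
        rewrite !in_itv/= => /andP[c1 c2] /andP[c3 c4].
      * have ij' : i' = j'.
          apply: t1 => //; exists c; split; by rewrite /= in_itv/= ?c1 ?c3.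
        by apply/val_inj; rewrite /= ei ej ij'.
      (* The open intervals of the two families lie on opposite sides of the middle point, so they
         share no point. *)
      * have [_ _ ? _] := h1 i'; have [? _ _ _] := h2 j'.
        exfalso; clear ei ej; lra.
      * have [_ _ ? _] := h1 j'; have [? _ _ _] := h2 i'.
        exfalso; clear ei ej; lra.
      * have ij' : i' = j'.
          apply: t2 => //; exists c; split; by rewrite /= in_itv/= ?c1 ?c3.
        by apply/val_inj; rewrite /= ei ej ij'.
    + rewrite big_split_ord /w/=.
      under eq_bigr do rewrite (unsplitK (inl _)).
      under [X in _ + (_ + X)]eq_bigr do rewrite (unsplitK (inr _)).
      have := ler_normD (f z - f y) (f y - f x).
      by rewrite subrKA; lra.
  - move=> x /andP[ax xb]; have [N'x|N'x] := pselect (N' x).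
      have /nbhs_ballP[g /= g0 gU] : nbhs x U.
        by apply: open_nbhs_nbhs; split => //; exact: NU.
      exists g => // s t as_ tb /andP[sx xt] gs tg.
      (* Near an exceptional point, the whole interval lies in [U] and is itself the family. *)
      exists 1%N, (fun=> s), (fun=> t); split.
      + move=> _; split => //; first exact: le_trans xt.
        move=> z /=; rewrite in_itv/= => /andP[sz zt]; apply: gU.
        by rewrite /ball/= ltr_norml; apply/andP; split; lra.
      + by move=> i j _ _ _; rewrite (ord1 i) (ord1 j).
      + by rewrite big_ord1 lerDr mulr_ge0 ?(ltW e0)// subr_ge0 (le_trans sx).
    have [xa xb'] : a != x /\ x != b.
      by split; apply: contra_notN N'x => /eqP xE; right; [left|right].
    have [dfx df0] : is_derive x 1 f 0.
      apply: contrapT => nd; apply: N'x; left; rewrite /N /= => h; apply: nd.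
      by apply: h; rewrite lt_neqAle xa ax lt_neqAle xb' xb.
    have : h^-1 *: (f (h *: 1 + x) - f x) @[h --> 0^'] --> 'D_1 f x by exact: dfx.
    rewrite df0 => /cvgrPdist_le/(_ _ e0)[g /= g0 gP].
    have H t : `|t - x| < g -> `|f t - f x| <= e * `|t - x|.
      have [->|tx] := eqVneq t x; first by rewrite !subrr normr0 mulr0.
      move=> tg; have tx0 : t - x != 0 by rewrite subr_eq0.
      have := gP (t - x).
      rewrite /ball_/= sub0r normrN [_ *: 1]mulr1 subrK => /(_ tg tx0).
      rewrite sub0r normrN normrM normfV mulrC ler_pdivrMr//.
      by rewrite normr_gt0.
    exists g => // s t as_ tb /andP[sx xt] gs tg.
    (* Near a point of zero derivative the length term suffices, with an empty family. *)
    exists 0%N, (fun=> 0), (fun=> 0); split; [by case|by case|].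
    rewrite big_ord0 addr0.
    have := ler_normD (f t - f x) (f x - f s); rewrite subrKA.
    have tx0 : 0 <= t - x by rewrite subr_ge0.
    have xs0 : 0 <= x - s by rewrite subr_ge0.
    have := H t; have := H s; rewrite (distrC (f s)) (distrC s).
    rewrite (ger0_norm tx0) (ger0_norm xs0) => Hs Ht.
    have {}Hs : `|f x - f s| <= e * (x - s) by apply: Hs; lra.
    have {}Ht : `|f t - f x| <= e * (t - x) by apply: Ht; lra.
    move: Hs Ht; rewrite !mulrBr; lra.
apply: (le_trans fab); rewrite lerD2l ltW//; apply: acd => //.
  by move=> i; have [] := uvU i.
rewrite (@le_lt_trans _ _ (d / 2))//; last lra.
rewrite -lee_fin (le_trans _ muU)// -[leRHS]/(lebesgue_measure U).
(* By disjointness the total length is the measure of a union contained in [U], hence at most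
   [d / 2]. *)
rewrite -sumEFin (eq_bigr (fun i => lebesgue_measure `]u i, v i[%classic)).
  rewrite -measure_bigsetU_ord//.
  rewrite le_measure ?inE//; first exact: bigsetU_measurable.
  by apply: (big_ind (fun A => A `<=` U)) => // [A B AU BU|i _];
    [rewrite subUset|have [] := uvU i].
move=> i _; rewrite lebesgue_measure_itv/= lte_fin.
have [_ uv _ _] := uvU i; case: ltP => // vu.
by have -> : v i - u i = 0 by lra.
Qed.

(** * Closure properties of absolute continuity *)

Lemma abs_continuous_id (R : realType) (a b : R) : abs_continuous a b id.
Proof.
move=> e e0; exists e => // n u v uv _; apply: le_lt_trans.
by apply: ler_sum => i _; have [_ uvi _] := uv i; rewrite ger0_norm// subr_ge0.
Qed.

(** Summing the increment bound over the intervals transfers the estimate to [h]. Lipschitz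
    functions, differences and products are all instances. *)
Lemma abs_continuous_dominated (R : realType) (a b M : R) (f g h : R -> R) :
  abs_continuous a b f -> abs_continuous a b g ->
  (forall u v, a <= u -> u <= v -> v <= b ->
    `|h v - h u| <= M * (`|f v - f u| + `|g v - g u|)) ->
  abs_continuous a b h.
Proof.
move=> acf acg hfg e e0; pose N := `|M| + 1.
have N0 : 0 < N by rewrite ltr_wpDl.
have eN : 0 < e / N / 2 by rewrite !divr_gt0.
have [d d0 df] := acf _ eN; have [d' d'0 dg] := acg _ eN.
exists (Num.min d d') => [|n u v uv tuv]; first by rewrite lt_min d0.
rewrite lt_min => /andP[/(df _ _ _ uv tuv) Sf /(dg _ _ _ uv tuv) Sg].
pose F i := `|f (v i) - f (u i)|; pose G i := `|g (v i) - g (u i)|.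
apply: (@le_lt_trans _ _ (\sum_i N * (F i + G i))).
  apply: ler_sum => i _; have [? ? ?] := uv i; apply: le_trans (hfg _ _ _ _ _) _ => //.
  by rewrite ler_wpM2r ?addr_ge0// (le_trans (ler_norm _))// lerDl.
rewrite -mulr_sumr big_split/= mulrC -ltr_pdivlMr//.
have -> : e / N = e / N / 2 + e / N / 2 by rewrite -splitr.
exact: ltrD.
Qed.

Lemma abs_continuous_lipschitz (R : realType) (a b M : R) (f : R -> R) :
  (forall u v, a <= u -> u <= v -> v <= b -> `|f v - f u| <= M * (v - u)) ->
  abs_continuous a b f.
Proof.
move=> fM; have acid := @abs_continuous_id R a b.
(* Both comparison functions are the identity, so the length counts twice and the constant is
   halved. *)
apply: (abs_continuous_dominated (M := M / 2) acid acid) => u v au uv vb.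
rewrite (le_trans (fM _ _ au uv vb))//= ger0_norm ?subr_ge0//.
by rewrite le_eqVlt; apply/orP; left; apply/eqP; field.
Qed.

Lemma abs_continuousB (R : realType) (a b : R) (f g : R -> R) :
  abs_continuous a b f -> abs_continuous a b g ->
  abs_continuous a b (fun x => f x - g x).
Proof.
move=> acf acg; apply: (abs_continuous_dominated (M := 1) acf acg) => u v _ _ _.
have -> : f v - g v - (f u - g u) = f v - f u - (g v - g u) by ring.
by rewrite mul1r ler_normB.
Qed.

Lemma abs_continuous_within (R : realType) (a b : R) (f : R -> R) :
  abs_continuous a b f -> {within `[a, b], continuous f}.
Proof.
move=> acf; apply/subspace_continuousP => x /=; rewrite in_itv/= => /andP[ax xb].
apply/cvgrPdist_lt => e e0; have [d d0 fd] := acf _ e0.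
rewrite near_withinE; exists d => //= t xtd; rewrite in_itv/= => /andP[at_ tb].
have ac1 u v : a <= u -> u <= v -> v <= b -> v - u < d -> `|f v - f u| < e.
  move=> au uv vb uvd; have := fd 1%N (fun=> u) (fun=> v).
  rewrite !big_ord1; apply => // i j _ _ _; by rewrite (ord1 i) (ord1 j).
move: xtd; rewrite /ball_/from_subspace/=; have [xt|/ltW tx] := leP x t.
by rewrite distrC ger0_norm ?subr_ge0// distrC; exact: ac1.
by rewrite ger0_norm ?subr_ge0//; exact: ac1.
Qed.

Lemma within_continuous_bounded (R : realType) (a b : R) (f : R -> R) :
  {within `[a, b], continuous f} ->
  exists M : R, forall x, a <= x <= b -> `|f x| <= M.
Proof.
move=> cf; have cK := continuous_compact cf (@segment_compact R a b).
have [M [Mr HM]] := compact_bounded cK.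
exists (M + 1) => x xab; apply: (HM (M + 1)); first by rewrite ltrDl.
by exists x => //=; rewrite in_itv.
Qed.

(** Both factors are bounded, being continuous on a compact segment, so the product rule for
    increments dominates those of the product. *)
Lemma abs_continuousM (R : realType) (a b : R) (f g : R -> R) :
  abs_continuous a b f -> abs_continuous a b g ->
  abs_continuous a b (fun x => f x * g x).
Proof.
move=> acf acg.
have [A fA] := within_continuous_bounded (abs_continuous_within acf).
have [B gB] := within_continuous_bounded (abs_continuous_within acg).
apply: (abs_continuous_dominated (M := Num.max A B) acf acg) => u v au uv vb.
have -> : f v * g v - f u * g u = (f v - f u) * g v + f u * (g v - g u) by ring.
apply: (le_trans (ler_normD _ _)); rewrite !normrM mulrDr (mulrC `|_ - _|).
apply: lerD; apply: ler_wpM2r => //; rewrite le_max.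
  by rewrite gB ?orbT// vb (le_trans au).
by rewrite fA ?au ?(le_trans uv).
Qed.

(** * Passage from complex functions to their real and imaginary parts *)

Lemma Re_le_modulus (R : realType) (z : R[i]) : `|complex.Re z| <= modulus z.
Proof.
by case: z => x t; rewrite /modulus/= -sqrtr_sqr ler_wsqrtr// lerDl sqr_ge0.
Qed.

Lemma Im_le_modulus (R : realType) (z : R[i]) : `|complex.Im z| <= modulus z.
Proof.
by case: z => x t; rewrite /modulus/= -sqrtr_sqr ler_wsqrtr// lerDr sqr_ge0.
Qed.

Lemma modulus_sqr (R : realType) (z : R[i]) :
  modulus z ^+ 2 = complex.Re z ^+ 2 + complex.Im z ^+ 2.
Proof. by case: z => x t; rewrite /modulus/= sqr_sqrtr// addr_ge0 ?sqr_ge0. Qed.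

Lemma abs_continuousC_Re (R : realType) (a b : R) (f : R -> R[i]) :
  abs_continuousC a b f -> abs_continuous a b (fun x => complex.Re (f x)).
Proof.
move=> acf e e0; have [d d0 fd] := acf _ e0; exists d => // n u v uv tuv duv.
apply: le_lt_trans (fd n u v uv tuv duv); apply: ler_sum => i _.
by rewrite (le_trans _ (Re_le_modulus _))// raddfB.
Qed.

Lemma abs_continuousC_Im (R : realType) (a b : R) (f : R -> R[i]) :
  abs_continuousC a b f -> abs_continuous a b (fun x => complex.Im (f x)).
Proof.
move=> acf e e0; have [d d0 fd] := acf _ e0; exists d => // n u v uv tuv duv.
apply: le_lt_trans (fd n u v uv tuv duv); apply: ler_sum => i _.
by rewrite (le_trans _ (Im_le_modulus _))// raddfB.
Qed.

(** * Derivatives taken within the segment *)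

(** Multiplying out the difference quotient gives a first-order expansion without division, which
    also covers [t = x]. *)
Lemma derivable_segP (R : realType) (a b x : R) (f : R -> R) :
  derivable_seg a b f x -> forall e : R, 0 < e -> exists2 d : R, 0 < d &
    forall t, a <= t <= b -> `|t - x| < d ->
      `|f t - f x - derive_seg a b f x * (t - x)| <= e * `|t - x|.
Proof.
move=> fx e e0; have {}fx : (f t - f x) / (t - x) @[t --> within `[a, b] x^'] -->
  derive_seg a b f x by exact: fx.
move/cvgrPdist_le : fx => /(_ _ e0); rewrite near_withinE => -[d /= d0 fd].
exists d => // t tab td; have [->|tx] := eqVneq t x.
  by rewrite !subrr mulr0 subrr normr0 mulr0.
have tx0 : t - x != 0 by rewrite subr_eq0.
rewrite -{1}(divfK tx0 (f t - f x)) -mulrBl normrM ler_wpM2r//.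
by rewrite distrC; apply: fd => //=; rewrite ?in_itv// distrC.
Qed.

Lemma derivable_seg_within (R : realType) (a b : R) (f : R -> R) :
  (forall x, a <= x <= b -> derivable_seg a b f x) ->
  {within `[a, b], continuous f}.
Proof.
move=> df; apply/subspace_continuousP => x /=; rewrite in_itv/= => xab.
have [d d0 fd] := derivable_segP (df _ xab) ltr01.
set D := derive_seg _ _ _ _ in fd; pose M := `|D| + 1.
have M0 : 0 < M by rewrite ltr_wpDl.
apply/cvgrPdist_lt => e e0; rewrite near_withinE.
exists (Num.min d (e / M)) => /=; first by rewrite lt_min d0 divr_gt0.
move=> t; rewrite /ball_/from_subspace/= lt_min distrC => /andP[td te]; rewrite in_itv/= => tab.
rewrite distrC -[f t - f x](subrK (D * (t - x))).
apply: (le_lt_trans (ler_normD _ _)).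
apply: (@le_lt_trans _ _ (M * `|t - x|)).
  by rewrite mulrDl addrC normrM lerD2l; exact: fd.
by rewrite mulrC -ltr_pdivlMr.
Qed.

Lemma derivable_seg_is_derive (R : realType) (a b x : R) (f : R -> R) :
  a < x < b -> derivable_seg a b f x -> is_derive x 1 f (derive_seg a b f x).
Proof.
move=> /andP[ax xb] fx; set D := derive_seg a b f x.
have fD : h^-1 *: (f (h *: 1 + x) - f x) @[h --> 0^'] --> D.
  apply/cvgrPdist_le => e e0; have [d d0 fd] := derivable_segP fx e0.
  (* The distances to the endpoints keep [h + x] inside the segment, where the one-sided and
     ordinary quotients agree. *)
  exists (Num.min d (Num.min (x - a) (b - x))) => /=.
    by rewrite !lt_min d0 !subr_gt0 ax.
  move=> h; rewrite /ball_/= sub0r normrN !lt_min => /and3P[hd ha hb] h0.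
  rewrite [_ *: 1]mulr1 distrC -(@ler_pM2r _ `|h|) ?normr_gt0// -normrM mulrBl.
  rewrite mulrC [_ *: _]mulrC [h * _]mulrC -mulrA mulVf// mulr1.
  have := fd (h + x); rewrite addrK; apply => //.
  by move: ha hb; rewrite !ltr_norml => /andP[? ?] /andP[? ?]; apply/andP; split; lra.
by apply: DeriveDef; [apply/cvg_ex; exists D|apply: cvg_lim].
Qed.

(** The derivative is continuous on a compact segment, hence bounded, and the mean value theorem
    makes [f] Lipschitz. *)
Lemma abs_continuous_primitive (R : realType) (a b : R) (f : R -> R) :
  (forall x, a <= x <= b -> derivable_seg a b f x) ->
  abs_continuous a b (derive_seg a b f) -> abs_continuous a b f.
Proof.
move=> df acdf.
have [M fM] := within_continuous_bounded (abs_continuous_within acdf).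
apply: (@abs_continuous_lipschitz _ _ _ M) => u v au uv vb.
have sub x : u <= x <= v -> a <= x <= b.
  by move=> /andP[ux xv]; rewrite (le_trans au)// (le_trans xv).
have cf : {within `[u, v], continuous f}.
  apply: continuous_subspaceW (derivable_seg_within df) => x /=.
  by rewrite !in_itv/=; exact: sub.
have [|c cuv ->] := MVT_segment (df := derive_seg a b f) uv _ cf.
  move=> x; rewrite in_itv/= => /andP[ux xv].
  apply: derivable_seg_is_derive; first by rewrite (le_lt_trans au)// (lt_le_trans xv).
  by apply/df/sub; rewrite !ltW.
rewrite normrM (ger0_norm (_ : 0 <= v - u)) ?subr_ge0//.
by rewrite ler_wpM2r ?subr_ge0//; apply/fM/sub; move: cuv; rewrite in_itv.
Qed.

(** * Boundedness and measurability of piecewise continuous functions *)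

(* The values f u and f v are unrelated to the one-sided limits. *)
Lemma piece_bounded_measurable (R : realType) (u v : R) (f : R -> R) :
  u < v -> (forall x, u < x < v -> {for x, continuous f}) ->
  cvg (f t @[t --> u^'+]) -> cvg (f t @[t --> v^'-]) ->
  (exists M : R, forall x, u <= x <= v -> `|f x| <= M) /\
  measurable_fun `[u, v] f.
Proof.
move=> uv fc /cvg_ex[l fl] /cvg_ex[m fm]; split; last first.
  have [r urv] : exists r, u < r < v.
    by exists ((u + v) / 2); apply/andP; split; lra.
  have : measurable_fun `]u, v[ f.
    by apply: open_continuous_measurable_fun => // x; rewrite inE/= in_itv/=; exact: fc.
  by move=> /measurable_fun_itv_obnd_cbndP/measurable_fun_itv_bndo_bndcP.
(* Replacing the endpoint values by the one-sided limits gives a function continuous on the closed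
   piece, hence bounded there. *)
pose k t := if t == u then l else if t == v then m else f t.
have kf : {in `]u, v[, k =1 f}.
  by move=> t; rewrite in_itv/= /k => /andP[ut tv]; rewrite gt_eqF// lt_eqF.
have ck : {within `[u, v], continuous k}.
  have ku : k u = l by rewrite /k eqxx.
  have kv : k v = m by rewrite /k eqxx gt_eqF.
  apply/continuous_within_itvP => //; rewrite ku kv; split.
  - move=> x xuv; rewrite /prop_for/continuous_at kf//.
    have {}fc : f t @[t --> x] --> f x by apply: fc; rewrite in_itv in xuv.
    apply: cvg_trans fc; apply: near_eq_cvg.
    near=> t; apply/esym/kf; near: t; exact: near_in_itvoo.
  - apply: cvg_trans fl; apply: near_eq_cvg; near=> t; apply/esym/kf.
    rewrite in_itv/=; apply/andP; split; near: t.
      exact: nbhs_right_gt.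
    exact: nbhs_right_lt.
  - apply: cvg_trans fm; apply: near_eq_cvg; near=> t; apply/esym/kf.
    rewrite in_itv/=; apply/andP; split; near: t.
      exact: nbhs_left_gt.
    exact: nbhs_left_lt.
have [M kM] := within_continuous_bounded ck.
exists (Num.max M (Num.max `|f u| `|f v|)) => x /andP[ux xv].
rewrite !le_max; have [->|xu] := eqVneq x u; first by rewrite lexx orbT.
have [->|xv'] := eqVneq x v; first by rewrite lexx !orbT.
have /kf <- : x \in `]u, v[ by rewrite in_itv/= !lt_neqAle ux xv xv' eq_sym xu.
by rewrite kM// ux.
Unshelve. all: by end_near. Qed.

Lemma piecewise_continuous_bounded_measurable (R : realType) (a b : R) (f : R -> R) :
  piecewise_continuous a b f ->
  (exists M : R, forall x, a <= x <= b -> `|f x| <= M) /\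
  measurable_fun `[a, b] f.
Proof.
case=> s; elim: s a => [|c s IH] a [] sab.
  rewrite (itv_partition_nil sab) => _; split; last first.
    by rewrite set_itv1; exact: measurable_fun_set1.
  by exists `|f b| => x; rewrite -eq_le eq_sym => /eqP->.
move=> pc; have [ac0 cb0] := (sab, itv_partition_cons sab).
have ac : a < c by move: ac0 => [/= /andP[]].
have cb : c <= b by exact: itv_partition_le cb0.
have [|[M fM] mf] := IH c; first by split => // i ilt; exact: (pc i.+1).
have [fc fa fb] := pc 0%N isT.
have [[N fN] mf'] := piece_bounded_measurable ac fc fa fb.
split.
  exists (Num.max N M) => x /andP[ax xb]; rewrite le_max.
  have [xc|/ltW cx] := leP x c; first by rewrite fN// ax.
  by rewrite fM ?orbT// cx.
have -> : `[a, b]%classic = `[a, c] `|` `[c, b].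
  apply/seteqP; split => x /=; rewrite !in_itv/=.
    by move=> /andP[-> ->]; rewrite andbT; have [|/ltW] := leP x c; [left|right].
  by case=> /andP[h1 h2]; rewrite ?h1 ?h2 ?(le_trans _ h1) ?(le_trans h2)// ltW.
by apply/measurable_funU.
Qed.

(** * Primitives of bounded measurable functions *)

(** The primitive is Lipschitz because the integrand is bounded, and the Lebesgue form of the
    fundamental theorem gives its derivative almost everywhere. *)
Lemma bounded_primitive (R : realType) (a b M : R) (h : R -> R) :
  measurable_fun `[a, b] h -> (forall x, a <= x <= b -> `|h x| <= M) ->
  exists H : R -> R, [/\
    forall x, a <= x <= b -> H x = \int[lebesgue_measure]_(t in `[a, x]) h t,
    abs_continuous a b H &
    {ae lebesgue_measure, forall x, a < x < b -> is_derive x 1 H (h x)}].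
Proof.
(* Extension by zero makes the integrand integrable over every measurable set, including intervals
   that leave the segment. *)
move=> mh hM; pose g := h \_ `[a, b].
have ih : lebesgue_measure.-integrable `[a, b] (EFin \o h).
  apply: measurable_bounded_integrable => //; first exact/compact_finite_measure/segment_compact.
  exists M; split; first exact: num_real.
  by move=> N MN x /=; rewrite in_itv/= => /hM/le_trans; apply; exact: ltW.
have iT : lebesgue_measure.-integrable setT (EFin \o g).
  by move: ih; rewrite integrable_mkcond//= (restrict_EFin h).
have ig (A : set R) : measurable A -> lebesgue_measure.-integrable A (EFin \o g).
  by move=> mA; exact: integrableS iT.
have gM x : `|g x| <= `|M|.
  rewrite /g patchE; case: ifPn => [|_]; last by rewrite normr0.
  by rewrite inE/= in_itv/= => /hM/le_trans; apply; exact: ler_norm.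
exists (fun x => \int[lebesgue_measure]_(t in `[a, x]) g t); split.
- move=> x /andP[ax xb]; rewrite -Rintegral_mkcondr; congr (Rintegral _ _ _).
  apply/seteqP; split => t /=; rewrite !in_itv/=; first by case.
  by move=> /andP[-> tx]; rewrite tx (le_trans tx).
- apply: (@abs_continuous_lipschitz _ _ _ `|M|) => u v au uv vb.
  rewrite Rintegral_itvB ?bnd_simp//; last exact: ig.
  apply: le_trans (le_normr_Rintegral _ _) _ => //; first exact: ig.
  have muv : lebesgue_measure `]u, v]%classic = (v - u)%:E.
    rewrite lebesgue_measure_itv/= lte_fin; case: ltP => // vu.
    by have -> : v - u = 0 by lra.
  have muvoo : (lebesgue_measure `]u, v]%classic < +oo)%E by rewrite muv ltry.
  have <- : \int[lebesgue_measure]_(t in `]u, v]) `|M| = `|M| * (v - u).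
    by rewrite Rintegral_cst// -[v - u]/(fine (v - u)%:E) -muv.
  apply: le_Rintegral => //.
    by apply: integrable_norm; exact: ig.
  apply: measurable_bounded_integrable => //.
  by exists `|M|; split=> [|N MN t _] /=; [exact: num_real|rewrite normr_id ltW].
- have := @FTC1 R g (BLeft a) (fun y => ig _ (measurable_itv _))
    (integrable_locally_restrict (measurable_itv _) ih).
  apply: filterS; first exact: (ae_filter_ringOfSetsType lebesgue_measure).
  move=> x + /andP[ax xb]; rewrite /= lte_fin => /(_ ax)[dg gx].
  apply: DeriveDef => //; rewrite -derive1E gx /g patchE mem_set//=.
  by rewrite in_itv/= !ltW.
Qed.

(** * The integral identity for the Wronskian *)

Lemma abs_continuous_sub (R : realType) (a b c : R) (f : R -> R) :
  c <= b -> abs_continuous a b f -> abs_continuous a c f.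
Proof.
move=> cb acf e e0; have [d d0 fd] := acf _ e0; exists d => // n u v uv.
by apply: fd => i; have [? ? ?] := uv i; split => //; exact: le_trans cb.
Qed.

Lemma wronskian_Rintegral (R : realType) (a b : R) (q r : R -> R)
    (lambda : R[i]) (y : R -> R[i]) (x : R) :
  let phi t := complex.Re (y t) in
  let psi t := complex.Im (y t) in
  piecewise_continuous a b r -> solution a b q r lambda y -> y a = 0 ->
  a <= x <= b ->
  derive_seg a b phi x * psi x - phi x * derive_seg a b psi x =
  complex.Im lambda *
    \int[lebesgue_measure]_(t in `[a, x]) (r t * modulus (y t) ^+ 2).
Proof.
move=> phi psi pr [[dy acdy] eqn] ya xab.
have dphi t : a <= t <= b -> derivable_seg a b phi t by move=> /dy[].
have dpsi t : a <= t <= b -> derivable_seg a b psi t by move=> /dy[].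
set phi' := derive_seg a b phi; set psi' := derive_seg a b psi.
have acphi' : abs_continuous a b phi' by exact: abs_continuousC_Re acdy.
have acpsi' : abs_continuous a b psi' by exact: abs_continuousC_Im acdy.
have acphi := abs_continuous_primitive dphi acphi'.
have acpsi := abs_continuous_primitive dpsi acpsi'.
pose m t := phi t * phi t + psi t * psi t.
have mE t : modulus (y t) ^+ 2 = m t by rewrite modulus_sqr !expr2.
have cphi := abs_continuous_within acphi.
have cpsi := abs_continuous_within acpsi.
have [[A rA] mr] := piecewise_continuous_bounded_measurable pr.
have [B phiB] := within_continuous_bounded cphi.
have [C psiC] := within_continuous_bounded cpsi.
have mphi : measurable_fun `[a, b] phi by exact: subspace_continuous_measurable_fun.
have mpsi : measurable_fun `[a, b] psi by exact: subspace_continuous_measurable_fun.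
pose h t := r t * m t.
have mh : measurable_fun `[a, b] h.
  by apply: measurable_funM => //; apply: measurable_funD; exact: measurable_funM.
have hM t : a <= t <= b -> `|h t| <= A * (B * B + C * C).
  move=> tab; rewrite normrM ler_pM ?rA// (le_trans (ler_normD _ _))// !normrM.
  by rewrite lerD// ler_pM ?phiB ?psiC.
have [H [HE acH dH]] := bounded_primitive mh hM.
(* The difference of the two sides is absolutely continuous, has zero derivative almost everywhere
   and vanishes at [a]. *)
pose F t := phi' t * psi t - phi t * psi' t - complex.Im lambda * H t.
have accst : abs_continuous a b (fun=> complex.Im lambda).
  by apply: (@abs_continuous_lipschitz _ _ _ 0) => u v; rewrite subrr normr0 mul0r.
have acF : abs_continuous a b F.
  by apply: abs_continuousB; [apply: abs_continuousB|]; exact: abs_continuousM.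
have dF : {ae lebesgue_measure, forall t, a < t < b -> is_derive t 1 F 0}.
  apply: filterS2 dH eqn; first exact: (ae_filter_ringOfSetsType lebesgue_measure).
  move=> t dHt eqt tab.
  have tab' : a <= t <= b by case/andP: tab => *; rewrite !ltW.
  have [[d2phi d2psi] e2] := eqt tab'.
  have phi1 := derivable_seg_is_derive tab (dphi t tab').
  have psi1 := derivable_seg_is_derive tab (dpsi t tab').
  have phi2 := derivable_seg_is_derive tab d2phi.
  have psi2 := derivable_seg_is_derive tab d2psi.
  have dW := is_deriveB
    (is_deriveB (is_deriveM phi2 psi1) (is_deriveM phi1 psi2))
    (is_deriveZ (complex.Im lambda) (dHt tab)).
  apply: (is_derive_eq dW); move: e2; rewrite /derive_segC -/phi' -/psi'.
  case: lambda {dW F acF accst eqt} => la lb; rewrite /h /m /phi /psi.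
  set p2 := derive_seg a b phi' t; set s2 := derive_seg a b psi' t.
  rewrite -/phi -/psi; case: (y t) => u v /= [e2 e3].
  (* These are the real and imaginary parts of the equation, solved for the second derivatives. In
     [p2 * v - u * s2] the terms with [q] and [la] cancel, leaving
     [lb * r t * (u ^+ 2 + v ^+ 2)]. *)
  have -> : p2 = q t * u - la * r t * u + lb * r t * v by move: e2; lra.
  have -> : s2 = q t * v - la * r t * v - lb * r t * u by move: e3; lra.
  by rewrite /GRing.scale/=; ring.
move: (xab) => /andP[ax xb].
have : F a = F x.
  apply: abs_continuous_cst_ae ax (abs_continuous_sub xb acF) _.
  apply: filterS dF; first exact: (ae_filter_ringOfSetsType lebesgue_measure).
  by move=> t dFt /andP[a_t tx]; apply: dFt; rewrite a_t (lt_le_trans tx).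
have phia : phi a = 0 by rewrite /phi ya.
have psia : psi a = 0 by rewrite /psi ya.
have Ha : H a = 0 by rewrite HE ?lexx ?(le_trans ax)// set_itv1 Rintegral_set1.
rewrite /F phia psia Ha !mulr0 mul0r !subr0 HE//.
under [in X in _ -> X]eq_Rintegral do rewrite mE.
by move/esym/eqP; rewrite subr_eq0 => /eqP.
Qed.

(** * Local signs from derivatives, and monotonicity of quotients *)

(** Near [a] the first-order term dominates the error of the expansion. The combinations used later
    are [- psi], [phi - c * psi] and [- phi]. *)
Lemma derive_seg_lincomb_gt0 (R : realType) (a b A B : R) (f g : R -> R) :
  derivable_seg a b f a -> derivable_seg a b g a -> f a = 0 -> g a = 0 ->
  0 < A * derive_seg a b f a + B * derive_seg a b g a ->
  exists2 d : R, 0 < d &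
    forall t, a < t -> t <= b -> t < a + d -> 0 < A * f t + B * g t.
Proof.
move=> df dg fa ga; set S := (X in 0 < X) => S0.
(* With tolerance [S / N] for each function, the total error stays strictly below [S * (t - a)]. *)
pose N := `|A| + `|B| + 1; have N0 : 0 < N by rewrite ltr_wpDl// addr_ge0.
have e0 : 0 < S / N by rewrite divr_gt0.
have [d d0 fd] := derivable_segP df e0; have [d' d'0 gd] := derivable_segP dg e0.
exists (Num.min d d') => [|t a_t tb]; first by rewrite lt_min d0.
have ta0 : 0 < t - a by rewrite subr_gt0.
rewrite -ltrBlDl lt_min => /andP[td td'].
have tab : a <= t <= b by rewrite ltW.
have := fd t tab; have := gd t tab; rewrite gtr0_norm// fa ga !subr0.
move=> /(_ td') gt /(_ td) ft.
set u := _ - _ in ft; set v := _ - _ in gt.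
have -> : A * f t + B * g t = S * (t - a) - (- (A * u) - B * v).
  by rewrite /u /v /S; ring.
rewrite subr_gt0; apply: le_lt_trans (ler_norm _) _.
apply: le_lt_trans (ler_normB _ _) _; rewrite normrN !normrM.
apply: (@le_lt_trans _ _ ((`|A| + `|B|) * (S / N * (t - a)))).
  by rewrite mulrDl lerD// ler_wpM2l.
rewrite mulrA ltr_pM2r// mulrCA -[X in _ < X]mulr1 ltr_pM2l//.
by rewrite ltr_pdivrMr// mul1r ltrDl.
Qed.

Lemma derive_seg_left_zero_ge0 (R : realType) (a b x : R) (f : R -> R) :
  a < x <= b -> derivable_seg a b f x -> f x = 0 ->
  (forall t, a < t < x -> f t < 0) -> 0 <= derive_seg a b f x.
Proof.
move=> /andP[ax xb] df fx fneg; rewrite leNgt; apply/negP; set D := derive_seg _ _ _ _.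
(* With half the slope as tolerance, [f t] is at least [D * (t - x) / 2], which is positive to the
   left of [x]. *)
move=> D0; have e0 : 0 < - D / 2 by rewrite divr_gt0// oppr_gt0.
have [d d0 fd] := derivable_segP df e0.
pose t := Num.max ((a + x) / 2) (x - d / 2).
have a_t : a < t by rewrite lt_max; apply/orP; left; lra.
have tx : t < x by rewrite gt_max; apply/andP; split; lra.
have tx0 : t - x < 0 by rewrite subr_lt0.
have dt : `|t - x| < d.
  rewrite ltr0_norm// opprB ltrBlDr -ltrBlDl lt_max; apply/orP; right; lra.
have ft : f t < 0 by rewrite fneg ?a_t.
have tab : a <= t <= b by rewrite ltW//= (le_trans (ltW tx)).
have := fd t tab dt; rewrite fx subr0 (ltr0_norm tx0) -/D ler_norml => /andP[+ _].
have : 0 < D * (t - x) by rewrite nmulr_rgt0.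
lra.
Qed.

Lemma wronskian_lt0_div_decreasing (R : realType) (a b : R) (f g : R -> R) :
  (forall x, a < x < b -> derivable f x 1) ->
  (forall x, a < x < b -> derivable g x 1) ->
  (forall x, a < x < b -> g x != 0) ->
  (forall x, a < x < b -> 'D_1 f x * g x - f x * 'D_1 g x < 0) ->
  forall u v, a < u -> u < v -> v < b -> f v / g v < f u / g u.
Proof.
move=> df dg g0 W u v au uv vb.
pose D x := ('D_1 f x * g x - f x * 'D_1 g x) / g x ^+ 2.
have sub x : u <= x <= v -> a < x < b.
  by move=> /andP[ux xv]; rewrite (lt_le_trans au)// (le_lt_trans xv).
have dq x : u <= x <= v -> is_derive x 1 (fun t => f t / g t) (D x).
  move=> /sub xab; have gx := g0 _ xab.
  have [fx gx'] := (derivableP (df _ xab), derivableP (dg _ xab)).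
  have dfg := is_deriveM fx (is_deriveV gx gx').
  by apply: (is_derive_eq dfg); rewrite /D /GRing.scale/=; field.
have [||c] := MVT_segment (f := fun t => f t / g t) (df := D) (ltW uv).
- by move=> x; rewrite in_itv/= => /andP[ux xv]; apply: dq; rewrite !ltW.
- apply: derivable_within_continuous => x; rewrite in_itv/= => /dq d.
  exact: ex_derive.
rewrite in_itv/= => /sub cab /eqP; rewrite subr_eq => /eqP ->.
rewrite gtrDr pmulr_llt0 ?subr_gt0// pmulr_llt0 ?W//.
by rewrite invr_gt0 exprn_even_gt0// g0.
Qed.

(** * The sign of the real part before the first zero of the imaginary part *)

Theorem corollary5 (R : realType) (a b : R) (q r : R -> R)
    (lambda : R[i]) (y : R -> R[i]) (phi psi G : R -> R) (x0 : R)
    (hab : a < b)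
    (hq : piecewise_continuous a b q)
    (hr : piecewise_continuous a b r)
    (hnd : non_definite a b q r)
    (hghost : complex_ghost a b q r lambda y)
    (hlambda : 0 < complex.Im lambda)
    (hphi : phi = (fun x => complex.Re (y x)))
    (hpsi : psi = (fun x => complex.Im (y x)))
    (hG : G = (fun x =>
       \int[lebesgue_measure]_(t in `[a, x]) (r t * modulus (y t) ^+ 2)))
    (hGneg : forall x, a < x < b -> G x < 0)
    (hpsia : derive_seg a b psi a < 0)
    (hx0 : a < x0 < b)
    (hpsix0 : psi x0 = 0)
    (hx0min : forall x, a < x < b -> psi x = 0 -> x0 <= x) :
  [/\ (0 < derive_seg a b phi a -> forall x, a < x < x0 -> 0 < phi x),
      (derive_seg a b phi a < 0 ->
         exists! x : R, a < x < x0 /\ phi x = 0) &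
      (derive_seg a b phi a = 0 ->
         (forall x, a < x < x0 -> 0 < phi x) \/
         (exists! x : R, a < x < x0 /\ phi x = 0))].
Proof.
have [[sol ya _ _] _] := hghost; have [[dy _] _] := sol.
have dphi t : a <= t <= b -> derivable_seg a b phi t by rewrite hphi => /dy[].
have dpsi t : a <= t <= b -> derivable_seg a b psi t by rewrite hpsi => /dy[].
have phia : phi a = 0 by rewrite hphi ya.
have psia : psi a = 0 by rewrite hpsi ya.
have aab : a <= a <= b by rewrite lexx ltW.
have W x : a < x < b ->
    derive_seg a b phi x * psi x - phi x * derive_seg a b psi x < 0.
  move=> xab; have /andP[ax xb] := xab.
  rewrite hphi hpsi (wronskian_Rintegral hr sol ya) ?ltW//.
  by rewrite pmulr_rlt0//; move: (hGneg _ xab); rewrite hG.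
have /andP[ax0 x0b] := hx0.
have sub x : a < x < x0 -> a < x < b.
  by move=> /andP[-> xx0]; exact: lt_trans x0b.
have IVT0 (f : R -> R) u v : (forall t, a <= t <= b -> derivable_seg a b f t) ->
    a < u -> u < v -> v < b -> f u < 0 -> 0 <= f v ->
    exists2 c, u < c <= v & f c = 0.
  move=> df au uv vb fu fv.
  have [||c] := @IVT R f u v 0 (ltW uv).
  - apply: continuous_subspaceW (derivable_seg_within df) => x /=.
    rewrite !in_itv/= => /andP[ux xv].
    by rewrite (le_trans (ltW au))// (le_trans xv)// ltW.
  - by rewrite ge_min le_max (ltW fu) fv orbT.
  rewrite in_itv/= => /andP[uc cv] fc0; exists c => //.
  rewrite cv andbT lt_neqAle uc andbT; apply: contraTneq fu => ->.
  by rewrite fc0 ltxx.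
(* The function [psi] is negative just after [a]; a nonnegative value before [x0] would yield, by
   the intermediate value theorem, a zero smaller than [x0]. *)
have psi_lt0 x : a < x < x0 -> psi x < 0.
  move=> xax0; have /andP[ax xx0] := xax0; rewrite ltNge; apply/negP => psix.
  have [|d d0 H] := @derive_seg_lincomb_gt0 R a b 0 (-1) phi psi
    (dphi _ aab) (dpsi _ aab) phia psia; first by rewrite mul0r add0r mulN1r oppr_gt0.
  pose t := Num.min ((a + x) / 2) (a + d / 2).
  have a_t : a < t by rewrite lt_min; apply/andP; split; lra.
  have tx : t < x by rewrite gt_min; apply/orP; left; lra.
  have td : t < a + d by rewrite gt_min; apply/orP; right; lra.
  have psit : psi t < 0.
    have := H t a_t _ td; rewrite mul0r add0r mulN1r oppr_gt0; apply.
    by rewrite ltW// (lt_trans tx)// (lt_trans xx0).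
  have [c /andP[tc cx] psic] := IVT0 _ _ _ dpsi a_t tx (lt_trans xx0 x0b) psit psix.
  have := hx0min c; rewrite (lt_trans a_t tc) (le_lt_trans cx (lt_trans xx0 x0b)).
  by move=> /(_ isT psic); rewrite leNgt (le_lt_trans cx).
have decr u v : a < u -> u < v -> v < x0 -> phi v / psi v < phi u / psi u.
  have dE f x : a < x < x0 -> (forall t, a <= t <= b -> derivable_seg a b f t) ->
      is_derive x 1 f (derive_seg a b f x).
    move=> /sub xab df; apply: derivable_seg_is_derive => //; apply: df.
    by case/andP: xab => *; rewrite !ltW.
  apply: (@wronskian_lt0_div_decreasing R a x0 phi psi) => x xax0.
  - by have [] := dE _ _ xax0 dphi.
  - by have [] := dE _ _ xax0 dpsi.
  - by rewrite lt_eqF// psi_lt0.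
  - have [_ ->] := dE _ _ xax0 dphi; have [_ ->] := dE _ _ xax0 dpsi.
    exact/W/sub.
have phi_gt0 : 0 <= derive_seg a b phi a -> forall x, a < x < x0 -> 0 < phi x.
  move=> phi'a.
  (* This avoids taking the limit of the quotient at [a]. If its value at [m] were [c > 0], then
     [phi - c * psi] would have positive derivative at [a], so the quotient would be below [c] at
     some [t < m], against its decrease. *)
  have le0 m : a < m -> m < x0 -> phi m / psi m <= 0.
    move=> am mx0; rewrite leNgt; apply/negP; set c := phi m / psi m => c0.
    have [|d d0 H] := @derive_seg_lincomb_gt0 R a b 1 (- c) phi psi
      (dphi _ aab) (dpsi _ aab) phia psia.
      by rewrite mul1r mulNr -mulrN ltr_wpDl// mulr_gt0// oppr_gt0.
    pose t := Num.min ((a + m) / 2) (a + d / 2).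
    have a_t : a < t by rewrite lt_min; apply/andP; split; lra.
    have tm : t < m by rewrite gt_min; apply/orP; left; lra.
    have td : t < a + d by rewrite gt_min; apply/orP; right; lra.
    have tb : t <= b by rewrite ltW// (lt_trans tm)// (lt_trans mx0).
    have := H t a_t tb td; rewrite mul1r mulNr subr_gt0 ltNge => /negP; apply.
    rewrite -ler_ndivlMr ?psi_lt0 ?a_t ?(lt_trans tm)//.
    by rewrite ltW// decr.
  move=> x /andP[ax xx0].
  have psix : psi x < 0 by rewrite psi_lt0 ?ax.
  (* Comparison with the midpoint turns the weak bound into a strict one: the quotient at [x] is
     negative. *)
  have h1 : a < (a + x) / 2 by lra.
  have h2 : (a + x) / 2 < x by lra.
  have := lt_le_trans (decr _ _ h1 h2 xx0) (le0 _ h1 (lt_trans h2 xx0)).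
  by rewrite ltr_ndivrMr// mul0r.
(* A zero derivative of [phi] at [a] always leads to the first alternative of the third claim. *)
split; [by move=> /ltW|move=> phi'a|by move=> phi'a; left; apply: phi_gt0; rewrite phi'a].
have phix0 : 0 < phi x0.
  have x0ab : a <= x0 <= b by rewrite !ltW.
  have psi'x0 : 0 <= derive_seg a b psi x0.
    by apply: derive_seg_left_zero_ge0 => //; [rewrite ax0 ltW|exact: dpsi].
  have := W _ hx0; rewrite hpsix0 mulr0 sub0r oppr_lt0.
  (* If [psi] had zero derivative at [x0], the Wronskian would vanish there; so that derivative is
     positive and [phi x0] inherits the sign of the product. *)
  by move: psi'x0; rewrite le_eqVlt => /predU1P[<-|p0]; rewrite ?mulr0 ?ltxx ?pmulr_lgt0.
have [|d d0 H] := @derive_seg_lincomb_gt0 R a b (-1) 0 phi psi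
  (dphi _ aab) (dpsi _ aab) phia psia; first by rewrite mul0r addr0 mulN1r oppr_gt0.
pose t := Num.min ((a + x0) / 2) (a + d / 2).
have a_t : a < t by rewrite lt_min; apply/andP; split; lra.
have tx0 : t < x0 by rewrite gt_min; apply/orP; left; lra.
have td : t < a + d by rewrite gt_min; apply/orP; right; lra.
have phit : phi t < 0.
  have := H t a_t _ td; rewrite mul0r addr0 mulN1r oppr_gt0; apply.
  by rewrite ltW// (lt_trans tx0).
have [c /andP[tc cx] phic] := IVT0 _ _ _ dphi a_t tx0 x0b phit (ltW phix0).
have cx0 : c < x0.
  by rewrite lt_neqAle cx andbT; apply: contraTneq phix0 => <-; rewrite phic ltxx.
exists c; split; first by rewrite (lt_trans a_t tc) cx0.
move=> x [/andP[ax xx0] phix].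
(* Two distinct zeros would give the strictly decreasing quotient the value zero twice. *)
have [cx'|xc|//] := ltgtP c x.
  by have := decr _ _ (lt_trans a_t tc) cx' xx0; rewrite phic phix !mul0r ltxx.
by have := decr _ _ ax xc cx0; rewrite phic phix !mul0r ltxx.
Qed.
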